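(* Let $a,b,c,d$ be non-negative integers, $h\ne 0$ an integer, and $k\ge 1$ a real number such that $a^k+b^k=c^k+d^k$ and $(c+d)-(a+b)=h$. Let $S_1=a+b$, $S_2=c+d$, $S_0=\max\{S_1,S_2\}$ and $M=\max\{a,b,c,d\}$. Then $M\ge 2$ and \[ k\ \le\ M\log 2\ \le\ S_0\log 2 \] (natural logarithm). In particular, for fixed $S$ and $h\ne0$, there are no such solutions with $a+b=S$, $c+d=S+h$ and $k>\max\{S,S+h\}\log 2$. *)

(* Defs.v *)
From HB Require Import structures.
From mathcomp Require Export all_boot all_order all_algebra.
From mathcomp Require Export all_classical all_reals all_analysis.

Set Implicit Arguments.
Unset Strict Implicit.
Unset Printing Implicit Defensive.

Import Order.TTheory GRing.Theory Num.Theory.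
Local Open Scope ring_scope.

(* powR satisfies 0 `^ k = 0 for k != 0, so zero bases have their usual
   meaning here. *)
Definition equal_power_sums (R : realType) (a b c d : nat) (h : int) (k : R)
    : Prop :=
  [/\ h != 0,
      1 <= k,
      a%:R `^ k + b%:R `^ k = c%:R `^ k + d%:R `^ k :> R
    & (c + d)%:Z - (a + b)%:Z = h].

(* Main.v *)
(** By symmetry let [a] be the maximum [M].  Neither [c] nor [d] equals [a]:
    otherwise the two remaining powers, hence the two remaining bases, agree
    and [h = 0].  So [c, d <= M - 1] and [M^k <= 2 (M - 1)^k].  This excludes
    [M <= 1], and taking logarithms with [ln (1 - 1/M) <= - 1/M] yields
    [k / M <= ln 2]. *)

Require Import Defs.
From mathcomp Require Import all_boot all_order all_algebra.
From mathcomp Require Import all_classical all_reals all_analysis.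
From mathcomp Require Import zify ring lra.

Set Implicit Arguments.
Unset Strict Implicit.
Unset Printing Implicit Defensive.

Import Order.TTheory GRing.Theory Num.Theory.
Local Open Scope ring_scope.

Lemma natr_powR_inj (R : realType) (k : R) (m n : nat) :
  0 < k -> m%:R `^ k = n%:R `^ k :> R -> m = n.
Proof.
move=> k0 /(powR_injective k0) E; apply/eqP; rewrite -(eqr_nat R).
by apply/eqP/E; rewrite nnegrE ler0n.
Qed.

Lemma ler_nat_powR (R : realType) (k : R) (m n : nat) :
  0 <= k -> (m <= n)%N -> m%:R `^ k <= n%:R `^ k :> R.
Proof. by move=> k0 mn; rewrite ge0_ler_powR ?nnegrE ?ler0n ?ler_nat. Qed.

(** Logarithms turn the hypothesis into [k * (ln n.+1 - ln n) <= ln 2], and the gap between the two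
    logarithms is at least [1 / n.+1]. *)
Lemma succ_powR_le_double (R : realType) (k : R) (n : nat) :
  0 <= k -> (0 < n)%N -> n.+1%:R `^ k <= 2 * n%:R `^ k :> R ->
  k <= n.+1%:R * ln 2.
Proof.
move=> k0 n0 le_pow.
have n_gt0 : 0 < n%:R :> R by rewrite ltr0n.
have n1_gt0 : 0 < n.+1%:R :> R by rewrite ltr0n.
have le_log : k * ln n.+1%:R <= ln 2 + k * ln n%:R :> R.
  rewrite -!ln_powR -lnM ?posrE ?powR_gt0 ?ltr0n//.
  by rewrite ler_ln ?posrE ?mulr_gt0 ?powR_gt0.
have le_step : ln n%:R - ln n.+1%:R <= - n.+1%:R^-1 :> R.
  rewrite -ln_div ?posrE//.
  (* This is the shape for [ln (1 + x) <= x], whose side condition [-1 < x] amounts to [0 < n]. *)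
  have -> : n%:R / n.+1%:R = 1 + - n.+1%:R^-1 :> R.
    by rewrite -[n.+1%:R in LHS]natr1 -natr1; field; rewrite natr1 gt_eqF.
  by rewrite le_ln1Dx// ltrN2 invf_lt1// ltr1n.
rewrite mulrC -ler_pdivrMr//.
have : k * (ln n%:R - ln n.+1%:R) <= k * - n.+1%:R^-1 :> R.
  exact: ler_wpM2l.
rewrite mulrBr mulrN lerNr opprB => /le_trans; apply.
by rewrite lerBlDr.
Qed.

(** The form [a + b != c + d] forgets the sign of [h], so the two sides of the equation can be
    exchanged when the maximum lies on the right. *)
Lemma equal_powR_sums_max (R : realType) (k : R) (a b c d : nat) :
  0 < k -> a%:R `^ k + b%:R `^ k = c%:R `^ k + d%:R `^ k :> R ->
  (a + b != c + d)%N -> (c <= a)%N -> (d <= a)%N ->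
  (2 <= a)%N /\ k <= a%:R * ln 2.
Proof.
move=> k0 eq_pow neq_sum ca da.
have ca' : (c < a)%N.
  rewrite ltn_neqAle ca andbT; apply: contra neq_sum => /eqP ca_eq.
  by move: eq_pow; rewrite ca_eq => /addrI/(natr_powR_inj k0) ->.
have da' : (d < a)%N.
  rewrite ltn_neqAle da andbT; apply: contra neq_sum => /eqP da_eq.
  move: eq_pow; rewrite da_eq [RHS]addrC => /addrI/(natr_powR_inj k0) ->.
  by rewrite addnC.
(* The case [a = 0] contradicts [c < a]; for [a = n.+1] the strict bounds become [c <= n] and
   [d <= n]. *)
case: a => // n in ca' da' eq_pow {neq_sum ca da} *.
have le_pow : n.+1%:R `^ k <= 2 * n%:R `^ k :> R.
  have := @ler_nat_powR _ _ c n (ltW k0) ca'.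
  have := @ler_nat_powR _ _ d n (ltW k0) da'.
  have := powR_ge0 (b%:R : R) k; lra.
have n0 : (0 < n)%N.
  case: n le_pow {ca' da' eq_pow} => // .
  by rewrite powR0 ?gt_eqF// mulr0 powR1 ler10.
by split => //; exact: succ_powR_le_double (ltW k0) n0 le_pow.
Qed.

Theorem theorem6p2 (R : realType) :
  (forall (a b c d : nat) (h : int) (k : R),
     equal_power_sums a b c d h k ->
     let S1 := (a + b)%N in
     let S2 := (c + d)%N in
     let S0 := maxn S1 S2 in
     let M := maxn (maxn a b) (maxn c d) in
     [/\ (2 <= M)%N,
         k <= M%:R * ln 2
       & M%:R * ln 2 <= S0%:R * ln 2 :> R])
  /\
  (forall S h : int, h != 0 ->
     ~ exists (a b c d : nat) (k : R),
         [/\ equal_power_sums a b c d h k,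
             (a + b)%:Z = S,
             (c + d)%:Z = S + h
           & (Num.max S (S + h))%:~R * ln 2 < k]).
Proof.
have bound (a b c d : nat) (h : int) (k : R) : equal_power_sums a b c d h k ->
    let M := maxn (maxn a b) (maxn c d) in
    (2 <= M)%N /\ k <= M%:R * ln 2.
  move=> [h0 k1 eq_pow eq_h] M.
  have k0 : 0 < k by lra.
  have neq_sum : (a + b != c + d)%N by apply/eqP; lia.
  (* The maximum may be any of the four numbers; swapping summands or sides moves it to the first
     position. *)
  have [[-> ca da]|[-> cb db]|[-> ac bc]|[-> ad bd]] :
    [\/ [/\ M = a, (c <= a)%N & (d <= a)%N],
        [/\ M = b, (c <= b)%N & (d <= b)%N],
        [/\ M = c, (a <= c)%N & (b <= c)%N]
      | [/\ M = d, (a <= d)%N & (b <= d)%N]].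
    have [ME|[ME|[ME|ME]]] : M = a \/ M = b \/ M = c \/ M = d by lia.
    - by apply: Or41; split; lia.
    - by apply: Or42; split; lia.
    - by apply: Or43; split; lia.
    - by apply: Or44; split; lia.
  - exact: equal_powR_sums_max eq_pow neq_sum ca da.
  - apply: (@equal_powR_sums_max _ k b a c d) => //.
      by rewrite addrC.
    by rewrite addnC.
  - by apply: (equal_powR_sums_max k0 (esym eq_pow)); rewrite 1?eq_sym.
  - apply: (@equal_powR_sums_max _ k d c a b) => //.
      by rewrite addrC.
    by rewrite addnC eq_sym.
(* Each of the four numbers is at most the sum containing it, and [ln 2 >= 0]. *)
have le_M_S0 (a b c d : nat) :
    (maxn (maxn a b) (maxn c d))%:R * ln 2 <=
    (maxn (a + b) (c + d))%:R * ln 2 :> R.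
  by rewrite ler_wpM2r ?ln_ge0 ?ler1n// ler_nat; lia.
split=> [a b c d h k eq_sums S1 S2 S0 M|S h h0].
  by have [M2 kM] := bound _ _ _ _ _ _ eq_sums; split => //; exact: le_M_S0.
move=> [a [b [c [d [k [eq_sums abS cdS]]]]]].
(* The integer maximum is [S0], so the first part contradicts the assumed lower bound on [k]. *)
have -> : Num.max S (S + h) = (maxn (a + b) (c + d))%:Z.
  by rewrite -cdS -abS; lia.
apply/negP; rewrite -leNgt.
by have [_ /le_trans] := bound _ _ _ _ _ _ eq_sums; apply; exact: le_M_S0.
Qed.
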